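(* Let $n,m\ge2$, $N=n+m$, and let $A$ be the hollow pooled dissimilarity array, $C$ the hollow between-group indicator array, $a_E,c_E,\ell_E$ the edge vectors, $a_{n,m}=\|\ell_E\|>0$, $Z_N$ the incidence matrix and $M_{N,2}$ the residual projector, all as defined in the context. Then: (i) the residualized between-group pair indicator satisfies $$M_{N,2}\,c_E=\frac{\ell_E}{a_{n,m}^2};$$ (ii) consequently, the least-squares slope $\widehat\theta$ (the coefficient of $c_E$) in the linear model $a_E=Z_N\gamma+\theta c_E+e$ (with $\gamma\in\mathbb R^N$, $\theta\in\mathbb R$) is $$\widehat\theta=\ell_E^{\mathsf T}a_E=\overline A_{XY}-\frac{\overline A_{XX}+\overline A_{YY}}2=\frac{\mathcal E_{n,m}}2;$$ (iii) equivalently, if $\widetilde A$ and $\widetilde C$ denote the U-centered versions of $A$ and $C$ over all $N$ pooled labels, then $$\mathcal E_{n,m}=2a_{n,m}^2\sum_{1\le i<j\le N}\widetilde A_{ij}\widetilde C_{ij}.$$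
   Context: Let $X_1,\dots,X_n$ and $Y_1,\dots,Y_m$ be independent samples from probability distributions $P$ and $Q$ on a common space $\mathcal Z$, and let $\rho:\mathcal Z^2\to\mathbb R$ be a symmetric measurable dissimilarity for which $\mathbb E\rho(X,Y)$, $\mathbb E\rho(X,X')$ and $\mathbb E\rho(Y,Y')$ are finite, where $X,X'\sim P$ and $Y,Y'\sim Q$ are mutually independent. Pool the observations: $U_i=X_i$ for $i\le n$ and $U_{n+j}=Y_j$ for $1\le j\le m$; $G_i=1$ for $i\le n$ and $G_i=0$ for $n<i\le N=n+m$. For $i\neq j$ put $A_{ij}=\rho(U_i,U_j)$ and $C_{ij}=\mathbf 1\{G_i\ne G_j\}$, with zero diagonals. Edge vectors are indexed by pairs $1\le i<j\le N$: $a_E=(A_{ij})_{i<j}$, $c_E=(C_{ij})_{i<j}$. Block averages: $$\overline A_{XY}=\frac1{nm}\sum_{i\le n<j}A_{ij},\quad \overline A_{XX}=\frac2{n(n-1)}\sum_{i<j\le n}A_{ij},\quad \overline A_{YY}=\frac2{m(m-1)}\sum_{n<i<j\le N}A_{ij}.$$ The sample generalized-energy statistic is $\mathcal E_{n,m}=2\overline A_{XY}-\overline A_{XX}-\overline A_{YY}$. The vector $\ell_E=(\ell_{ij})_{i<j}$ has $\ell_{ij}=-\{n(n-1)\}^{-1}$ if $i<j\le n$, $\ell_{ij}=(nm)^{-1}$ if $i\le n<j$, and $\ell_{ij}=-\{m(m-1)\}^{-1}$ if $n<i<j$; $a_{n,m}:=\|\ell_E\|$ (Euclidean norm), so $a_{n,m}^2=\frac1{nm}+\frac1{2n(n-1)}+\frac1{2m(m-1)}$.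 The matrix $Z_N\in\mathbb R^{\binom N2\times N}$ has entries $(Z_N)_{\{i,j\},k}=\mathbf 1\{k\in\{i,j\}\}$, and $M_{N,2}=I-Z_N(Z_N^{\mathsf T}Z_N)^{-1}Z_N^{\mathsf T}$. For a symmetric $N\times N$ zero-diagonal array $B$, with $B_{i\cdot}=\sum_{j\ne i}B_{ij}$ and $B_{\cdot\cdot}=\sum_{i\neq j}B_{ij}$, its U-centered version is $\widetilde B_{ij}=B_{ij}-\frac{B_{i\cdot}+B_{j\cdot}}{N-2}+\frac{B_{\cdot\cdot}}{(N-1)(N-2)}$ for $i\neq j$, $\widetilde B_{ii}=0$. *)

(* Defs.v *)
From HB Require Import structures.
From mathcomp Require Import all_boot all_order all_algebra.
From mathcomp Require Import all_classical all_reals all_analysis.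

Set Implicit Arguments.
Unset Strict Implicit.
Unset Printing Implicit Defensive.

Import Order.TTheory GRing.Theory Num.Theory.
Import numFieldNormedType.Exports.

Local Open Scope classical_set_scope.
Local Open Scope ring_scope.

(** Labels are numbered from 0: the X-sample occupies [i < n] and the Y-sample
    occupies [n <= i < n + m]. *)

Definition pool (T : Type) (n m : nat) (x : 'I_n -> T) (y : 'I_m -> T)
    (i : 'I_(n + m)) : T :=
  match fintype.split i with inl k => x k | inr l => y l end.

Definition mutually_independent (dO dZ : measure_display)
    (Omega : measurableType dO) (Z : measurableType dZ) (R : realType)
    (Pr : probability Omega R) (I : finType) (U : I -> {RV Pr >-> Z}) : Prop :=
  forall (J : {set I}) (B : I -> set Z),
    (forall i, measurable (B i)) ->
    Pr (\bigcap_(i in [set` J]) (U i @^-1` B i)) =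
    (\prod_(i in J) Pr (U i @^-1` B i))%E.

Definition has_law (dO dZ : measure_display)
    (Omega : measurableType dO) (Z : measurableType dZ) (R : realType)
    (Pr : probability Omega R) (X : {RV Pr >-> Z}) (P : probability Z R) : Prop :=
  forall B : set Z, measurable B -> distribution Pr X B = P B.

Section Edges.
Variables (R : realType) (N : nat).

Definition edge : Type := {e : 'I_N * 'I_N | (e.1 < e.2)%N}.

Definition edge_at (e : 'I_#|{: edge}|) : 'I_N * 'I_N := val (enum_val e).

(** There are binomial(N, 2) edges, see [card_edge] below. *)
Definition edge_vec (B : 'I_N -> 'I_N -> R) : 'cV[R]_#|{: edge}| :=
  \col_e B (edge_at e).1 (edge_at e).2.

Definition incidence : 'M[R]_(#|{: edge}|, N) :=
  \matrix_(e, k) ((k == (edge_at e).1) || (k == (edge_at e).2))%:R.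

(** [incidence^T *m incidence] is invertible for [3 <= N]; only then is [invmx]
    its inverse. *)
Definition residual_proj : 'M[R]_#|{: edge}| :=
  1%:M - incidence *m invmx (incidence^T *m incidence) *m incidence^T.

Definition Ucenter (B : 'M[R]_N) : 'M[R]_N :=
  \matrix_(i, j)
    if i == j then 0 else
      B i j
      - (\sum_(k | k != i) B i k + \sum_(k | k != j) B j k) / (N%:R - 2)
      + (\sum_k \sum_(l | l != k) B k l) / ((N%:R - 1) * (N%:R - 2)).

End Edges.

Lemma card_edge (N : nat) : #|{: edge N}| = 'C(N, 2).
Proof.
rewrite card_sig -sum1_card.
rewrite -(pair_big_dep xpredT (fun i j : 'I_N => (i < j)%N) (fun _ _ => 1%N)) /=.
rewrite (exchange_big_dep xpredT) //= -bin2_sum big_mkord.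
apply: eq_bigr => j _; rewrite sum1_card.
have jN := ltnW (ltn_ord j).
have winj : injective (widen_ord jN) by move=> a b /(congr1 val) /= /val_inj.
rewrite -[RHS]card_ord -(card_imset _ winj).
apply: eq_card => i; apply/idP/imsetP => [ij | [k _ ->]]; last first.
  exact: (ltn_ord k).
by exists (Ordinal ij) => //; apply: val_inj.
Qed.

(** The library norm on matrices is the sup norm. *)
Definition sqnorm (R : realType) (k : nat) (v : 'cV[R]_k) : R :=
  \sum_i v i 0 ^+ 2.

Definition enorm (R : realType) (k : nat) (v : 'cV[R]_k) : R :=
  Num.sqrt (sqnorm v).

Definition least_squares_fit (R : realType) (k p : nat) (y : 'cV[R]_k)
    (Z : 'M[R]_(k, p)) (c : 'cV[R]_k) (gamma : 'cV[R]_p) (theta : R) : Prop :=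
  forall (gamma' : 'cV[R]_p) (theta' : R),
    sqnorm (y - (Z *m gamma + theta *: c)) <=
    sqnorm (y - (Z *m gamma' + theta' *: c)).

Section TwoSample.
Variables (R : realType) (n m : nat).

Definition dissim_array (T : Type) (rho : T * T -> R) (u : 'I_(n + m) -> T) :
    'M[R]_(n + m) :=
  \matrix_(i, j) if i == j then 0 else rho (u i, u j).

Definition group (i : 'I_(n + m)) : nat := (i < n)%N.

Definition between_array : 'M[R]_(n + m) :=
  \matrix_(i, j) (group i != group j)%:R.

Definition ell (i j : 'I_(n + m)) : R :=
  if (j < n)%N then - (n%:R * (n%:R - 1))^-1
  else if (i < n)%N then (n%:R * m%:R)^-1
  else - (m%:R * (m%:R - 1))^-1.

Definition ell_E := edge_vec ell.

Definition a_nm : R := enorm ell_E.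

Section Averages.
Variable A : 'M[R]_(n + m).

Definition avgXY : R :=
  (n%:R * m%:R)^-1 *
  \sum_(i : 'I_(n + m) | (i < n)%N) \sum_(j : 'I_(n + m) | (n <= j)%N) A i j.

Definition avgXX : R :=
  2 / (n%:R * (n%:R - 1)) *
  \sum_(i : 'I_(n + m)) \sum_(j : 'I_(n + m) | (i < j < n)%N) A i j.

Definition avgYY : R :=
  2 / (m%:R * (m%:R - 1)) *
  \sum_(i : 'I_(n + m)) \sum_(j : 'I_(n + m) | (n <= i < j)%N) A i j.

Definition sample_energy : R := 2 * avgXY - avgXX - avgYY.

End Averages.
End TwoSample.

Arguments incidence : clear implicits.
Arguments residual_proj : clear implicits.
Arguments between_array : clear implicits.
Arguments ell_E : clear implicits.
Arguments a_nm : clear implicits.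

(* Main.v *)
(** The vector [ell_E] is orthogonal to the columns of the incidence matrix [Z],
    and [c_E = Z beta + ell_E / |ell_E|^2] for an explicit [beta] that is constant
    on each group; hence [M c_E = ell_E / |ell_E|^2].  Reparametrizing the model by
    this decomposition makes the two regressors orthogonal, so the slope is
    [<ell_E, a_E>], which is a combination of the block averages.  U-centering a
    symmetric array subtracts a vector in the range of [Z] and leaves zero row
    sums, so it acts on edge vectors as [M]; then [<M a_E, M c_E>] equals
    [<M a_E, ell_E> / |ell_E|^2 = <a_E, ell_E> / |ell_E|^2]. *)

Require Import Defs.
From HB Require Import structures.
From mathcomp Require Import all_boot all_order all_algebra.
From mathcomp Require Import all_classical all_reals all_analysis.
From mathcomp Require Import ring lra zify.

Import Order.TTheory GRing.Theory Num.Theory.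
Import numFieldNormedType.Exports.

Local Open Scope classical_set_scope.
Local Open Scope ring_scope.

(** * Euclidean squared norm of column vectors *)

Section SquaredNorm.
Context {R : realType} {k : nat}.
Implicit Types u v : 'cV[R]_k.

Lemma sqnormE v : sqnorm v = (v^T *m v) 0 0.
Proof. by rewrite mxE; apply: eq_bigr => i _; rewrite mxE expr2. Qed.

Lemma sqnorm_ge0 v : 0 <= sqnorm v.
Proof. by apply: sumr_ge0 => i _; exact: sqr_ge0. Qed.

Lemma sqnormZ (t : R) v : sqnorm (t *: v) = t ^+ 2 * sqnorm v.
Proof. by rewrite mulr_sumr; apply: eq_bigr => i _; rewrite mxE exprMn. Qed.

Lemma tr_scale_mulmx (t : R) u v : (t *: v)^T *m u = t *: (v^T *m u).
Proof.
rewrite scalemxAl; congr (_ *m _).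
by apply/matrixP => i j; rewrite !mxE.
Qed.

Lemma sqnormB u v : sqnorm (u - v) = sqnorm u - 2 * (v^T *m u) 0 0 + sqnorm v.
Proof.
rewrite /sqnorm mxE mulr_sumr -sumrB -big_split; apply: eq_bigr => i _ /=.
by rewrite !mxE; ring.
Qed.

End SquaredNorm.

(** * Least squares with one extra regressor, split as [c = Z beta + l / |l|^2] with [l] orthogonal
    to [Z] *)

Section Regression.
Context {R : realType} {k p : nat} (Z : 'M[R]_(k, p)) (c l y : 'cV[R]_k).
Context (beta : 'cV[R]_p).
Hypotheses (ZZ_unit : Z^T *m Z \in unitmx) (Zl0 : Z^T *m l = 0).
Hypotheses (l_gt0 : 0 < sqnorm l).
Hypothesis cE : c = Z *m beta + (sqnorm l)^-1 *: l.

Let s := sqnorm l.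

Lemma tr_residual_dot : l^T *m Z = 0.
Proof. by rewrite -[LHS]trmxK trmx_mul trmxK Zl0 trmx0. Qed.

Lemma regressor_dot : (l^T *m c) 0 0 = 1.
Proof.
rewrite cE mulmxDr mulmxA tr_residual_dot mul0mx add0r -scalemxAr mxE.
by rewrite -sqnormE mulVf // gt_eqF.
Qed.

(** The residual [e] satisfies [l^T e = l^T y - theta]. If [d = l^T e] were nonzero, removing the
    [l]-component of [e] would lower the squared error by [d ^+ 2 / s], against minimality. *)
Lemma fit_slope (gamma : 'cV[R]_p) (theta : R) :
  least_squares_fit y Z c gamma theta -> theta = (l^T *m y) 0 0.
Proof.
move=> fit; set e := y - (Z *m gamma + theta *: c).
have le : (l^T *m e) 0 0 = (l^T *m y) 0 0 - theta.
  rewrite /e mulmxBr mulmxDr mulmxA tr_residual_dot mul0mx add0r -scalemxAr.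
  rewrite 2!mxE [in X in _ + X]mxE [X in _ - X]mxE [X in _ - _ * X]regressor_dot.
  by rewrite mulr1.
(* Moving along [(- d beta, d)] shifts the fitted vector by a multiple of [l]. *)
set d := (l^T *m e) 0 0 in le.
have := fit (gamma - d *: beta) (theta + d).
have -> : y - (Z *m (gamma - d *: beta) + (theta + d) *: c) = e - (d / s) *: l.
  rewrite /e mulmxBr -scalemxAr scalerDl [in d *: c]cE scalerDr scalerA.
  apply/matrixP => i j; rewrite !mxE /s; ring.
rewrite -/e (sqnormB e) sqnormZ tr_scale_mulmx mxE -/d -/s => h.
have {}h : d ^+ 2 / s <= 0.
  have s0 : s != 0 by rewrite gt_eqF.
  have -> : d ^+ 2 / s = 2 * (d / s * d) - (d / s) ^+ 2 * s by field.
  by lra.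
have : d ^+ 2 <= 0 by move: h; rewrite pmulr_lle0 ?invr_gt0.
rewrite le_eqVlt ltNge sqr_ge0 orbF sqrf_eq0 => /eqP d0.
by move: le; rewrite d0 => /esym/subr0_eq ->.
Qed.

Lemma tr_fitted_mulmx (b : 'cV[R]_p) (t : R) (w u : 'cV[R]_k) :
  (Z *m b + t *: w)^T *m u = b^T *m (Z^T *m u) + t *: (w^T *m u).
Proof.
have -> : (Z *m b + t *: w)^T = (Z *m b)^T + (t *: w)^T.
  by apply/matrixP => i j; rewrite !mxE.
by rewrite mulmxDl tr_scale_mulmx trmx_mul mulmxA.
Qed.

Lemma fit_exists : exists gamma theta, least_squares_fit y Z c gamma theta.
Proof.
set theta := (l^T *m y) 0 0.
set g0 := invmx (Z^T *m Z) *m (Z^T *m y).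
(* [y] is regressed separately on the orthogonal regressors [Z] and [l], with coefficients [g0] and
   [theta / s]; replacing [l / s] by [c - Z beta] gives these coefficients. *)
exists (g0 - theta *: beta), theta => gamma' theta'.
set e := y - _.
have eE : e = y - Z *m g0 - (theta / s) *: l.
  rewrite /e mulmxBr -scalemxAr cE scalerDr scalerA.
  by apply/matrixP => i j; rewrite !mxE /s; ring.
have Ze : Z^T *m e = 0.
  rewrite eE !mulmxBr -scalemxAr Zl0 scaler0 subr0 mulmxA /g0 mulmxA.
  by rewrite mulmxV // mul1mx subrr.
have le : l^T *m e = 0.
  apply/matrixP => i j; rewrite !ord1 eE !mulmxBr mulmxA tr_residual_dot mul0mx.
  rewrite subr0 -scalemxAr mxE [X in _ + X]mxE [X in _ - X]mxE -sqnormE -/theta.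
  by rewrite -/s divfK ?gt_eqF // subrr mxE.
have ce : c^T *m e = 0.
  by rewrite cE tr_fitted_mulmx Ze le mulmx0 scaler0 addr0.
(* Any other residual is [e - v] with [v] in the span of the regressors, to which [e] is orthogonal;
   Pythagoras concludes. *)
set v := Z *m (gamma' - (g0 - theta *: beta)) + (theta' - theta) *: c.
have -> : y - (Z *m gamma' + theta' *: c) = e - v.
  by rewrite /e /v !mulmxBr; apply/matrixP => i j; rewrite !mxE; ring.
have ve : v^T *m e = 0.
  by rewrite /v tr_fitted_mulmx Ze ce mulmx0 scaler0 addr0.
by rewrite (sqnormB e) ve mxE mulr0 subr0 lerDl sqnorm_ge0.
Qed.

End Regression.

(** * Edge vectors, the incidence matrix, its residual projector and U-centering *)

Section EdgeSums.
Context {R : realType} {N : nat}.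
Implicit Types B D : 'I_N -> 'I_N -> R.

Lemma sum_edge B :
  \sum_e B (edge_at e).1 (edge_at e).2 =
  \sum_(i < N) \sum_(j < N | (i < j)%N) B i j.
Proof.
rewrite pair_big_dep /=.
transitivity (\sum_(e : edge N) B (val e).1 (val e).2).
  rewrite [RHS](reindex (@enum_val (edge N) predT)) //.
  by apply: onW_bij; exact: enum_val_bij.
rewrite [RHS](reindex_omap (val : edge N -> _) insub) => [|q q12]; last first.
  by rewrite insubT.
by apply: eq_bigl => -[q q12] /=; rewrite insubT q12 /= eqxx.
Qed.

Lemma edge_vec_dot B D :
  ((edge_vec B)^T *m edge_vec D) 0 0 =
  \sum_(i < N) \sum_(j < N | (i < j)%N) B i j * D i j.
Proof. by rewrite mxE -sum_edge; apply: eq_bigr => e _; rewrite !mxE. Qed.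

Lemma eq_edge_vec B D :
  (forall i j : 'I_N, (i < j)%N -> B i j = D i j) -> edge_vec B = edge_vec D.
Proof.
by move=> BD; apply/matrixP => e j; rewrite !mxE BD //; exact: (valP (enum_val e)).
Qed.

Lemma incidence_edge_vec (g : 'cV[R]_N) :
  incidence R N *m g = edge_vec (fun i j => g i 0 + g j 0).
Proof.
apply/matrixP => e j; rewrite !mxE ord1.
set i1 := (edge_at e).1; set i2 := (edge_at e).2.
have ne : i2 != i1.
  by have /= h := valP (enum_val e); rewrite -val_eqE gtn_eqF.
rewrite (bigD1 i1) //= (bigD1 i2) //= big1 => [|h /andP[h1 h2]].
  by rewrite !mxE -/i1 -/i2 !eqxx orbT !mul1r addr0.
by rewrite !mxE -/i1 -/i2 (negbTE h1) (negbTE h2) mul0r.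
Qed.

Lemma tr_incidence_edge_vec B (B_sym : forall i j, B i j = B j i) :
  (incidence R N)^T *m edge_vec B = \col_k \sum_(j | j != k) B k j.
Proof.
apply/matrixP => k z; rewrite ord1 !mxE {z}.
under eq_bigr do rewrite !mxE.
rewrite (sum_edge (fun i j => ((k == i) || (k == j))%:R * B i j)).
(* The row [i = k] collects the edges with smaller endpoint [k]; a row [i < k] keeps only the edge
   from [i] to [k], and a row [i > k] keeps nothing. *)
rewrite (bigD1 k) //= [RHS](bigID (fun j : 'I_N => (k < j)%N)) /=.
congr (_ + _).
  rewrite [LHS]big_mkcond [RHS]big_mkcond; apply: eq_bigr => j _.
  rewrite eqxx mul1r andbC; case: ltnP => //= kj.
  by rewrite -val_eqE /= gtn_eqF.
rewrite [LHS]big_mkcond [RHS]big_mkcond; apply: eq_bigr => i _.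
rewrite -leqNgt -val_eqE /=; case: ltngtP => //= ik.
- rewrite (bigD1 k) //= eqxx orbT mul1r big1 ?addr0 //.
  move=> j /andP[_ jk]; rewrite eq_sym in jk.
  by rewrite (negbTE jk) -val_eqE /= gtn_eqF // mul0r.
- apply: big1 => j ij.
  by rewrite -!val_eqE /= (ltn_eqF ik) (ltn_eqF (ltn_trans ik ij)) mul0r.
Qed.

(** Each column of the incidence matrix is the edge vector of a symmetric array, so its products
    with the columns are row sums: [N - 1] on the diagonal and 1 elsewhere. *)
Lemma incidence_gram :
  (incidence R N)^T *m incidence R N = (N%:R - 2)%:M + const_mx 1.
Proof.
apply/matrixP => k l.
pose B (i j : 'I_N) : R := ((l == i) || (l == j))%:R.
transitivity (((incidence R N)^T *m edge_vec B) k 0).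
  by rewrite !mxE; apply: eq_bigr => e _; rewrite !mxE.
rewrite tr_incidence_edge_vec => [|i j]; last by rewrite /B orbC.
rewrite !mxE /B eq_sym; case: eqVneq => [->|kl] /=.
  rewrite sumr_const cardC1 card_ord mulr1n.
  by case: N k => [[]//|N' _] /=; rewrite -natr1; ring.
rewrite (bigD1 l) ?eqxx //=; last by rewrite eq_sym.
rewrite big1 ?mulr0n ?addr0 ?add0r // => j /andP[_ jl].
by rewrite eq_sym (negbTE jl).
Qed.

Hypothesis N_ge3 : (3 <= N)%N.

Lemma incidence_gram_unit : (incidence R N)^T *m incidence R N \in unitmx.
Proof.
have N3 : (3 : R) <= N%:R by rewrite (ler_nat R 3 N).
have [n2 n1] : N%:R - 2 != 0 :> R /\ N%:R - 1 != 0 :> R by split; lra.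
rewrite incidence_gram.
(* Sherman-Morrison inverse of a scalar matrix plus the all-ones matrix; [2 (N - 1)] is
   [(N - 2) + N]. *)
pose W : 'M[R]_N := (N%:R - 2)^-1%:M - const_mx ((2 * (N%:R - 1) * (N%:R - 2))^-1).
suff /mulmx1_unit[] : ((N%:R - 2)%:M + const_mx 1) *m W = 1%:M by [].
have cc : (const_mx 1 : 'M[R]_N) *m const_mx ((2 * (N%:R - 1) * (N%:R - 2))^-1) =
    const_mx (N%:R / (2 * (N%:R - 1) * (N%:R - 2))) :> 'M[R]_N.
  apply/matrixP => i j; rewrite !mxE.
  under eq_bigr do rewrite !mxE mul1r.
  by rewrite sumr_const card_ord [RHS]mulr_natl.
rewrite /W mulmxDl !mulmxBr cc !mul_scalar_mx mul_mx_scalar.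
apply/matrixP => i j; rewrite !mxE; case: (i == j); rewrite ?mulr1n ?mulr0n;
  by field; rewrite n1 n2.
Qed.

(** Lets a projection be read off from any splitting into a range part and an orthogonal part, so
    that [invmx] never has to be computed. *)
Lemma residual_proj_decomp (y r : 'cV[R]_#|{: edge N}|) (g : 'cV[R]_N) :
  y = incidence R N *m g + r -> (incidence R N)^T *m r = 0 ->
  residual_proj R N *m y = r.
Proof.
move=> -> Zr; rewrite /residual_proj mulmxBl mul1mx -[X in _ - X]mulmxA mulmxDr Zr.
rewrite addr0 -mulmxA [X in invmx _ *m X]mulmxA mulKmx ?incidence_gram_unit //.
by rewrite addrAC subrr add0r.
Qed.

Lemma Ucenter_sym (B : 'M[R]_N) :
  (forall i j, B i j = B j i) -> forall i j, Ucenter B i j = Ucenter B j i.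
Proof.
move=> Bs i j; rewrite !mxE eq_sym Bs; case: eqP => // _.
by congr (_ - _ / _ + _); rewrite addrC.
Qed.

Lemma Ucenter_row_sum (B : 'M[R]_N) k : \sum_(j | j != k) Ucenter B k j = 0.
Proof.
have N3 : (3 : R) <= N%:R by rewrite (ler_nat R 3 N).
have [n2 n1] : N%:R - 2 != 0 :> R /\ N%:R - 1 != 0 :> R by split; lra.
pose r i := \sum_(j | j != i) B i j; pose S := \sum_i r i.
transitivity (\sum_(j | j != k)
    (B k j - (r k + r j) / (N%:R - 2) + S / ((N%:R - 1) * (N%:R - 2)))).
  by apply: eq_bigr => j jk; rewrite mxE eq_sym (negbTE jk).
rewrite big_split sumrB /= -mulr_suml big_split /= !sumr_const cardC1 card_ord.
(* With the [N - 1] copies of [r k], the subtracted row sums total [(N - 2) r k + S]; division by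
   [N - 2] cancels the row sum, and the last term restores [S / (N - 2)]. *)
have -> : \sum_(j | j != k) r j = S - r k.
  by rewrite /S [X in _ = X - _](bigD1 k) //= [RHS]addrC addKr.
have N1 : N.-1%:R = N%:R - 1 :> R by rewrite -subn1 natrB //; lia.
rewrite -/(r k) -[r k *+ _]mulr_natl -[_ / _ *+ _]mulr_natl N1.
move: (r k) S => rk S'; field.
by rewrite n1 n2.
Qed.

Lemma edge_vec_Ucenter (B : 'M[R]_N) : (forall i j, B i j = B j i) ->
  edge_vec (Ucenter B) = residual_proj R N *m edge_vec B.
Proof.
move=> Bs; have N3 : (3 : R) <= N%:R by rewrite (ler_nat R 3 N).
have [n2 n1] : N%:R - 2 != 0 :> R /\ N%:R - 1 != 0 :> R by split; lra.
pose r i := \sum_(j | j != i) B i j; pose S := \sum_i r i.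
(* The grand-total term of the U-centering is shared equally between the two endpoints, hence the
   factor 2. *)
pose g : 'cV[R]_N :=
  \col_i (r i / (N%:R - 2) - S / (2 * (N%:R - 1) * (N%:R - 2))).
apply/esym/(@residual_proj_decomp _ _ g).
  rewrite incidence_edge_vec; apply/matrixP => e j; rewrite !mxE.
  have /= h := valP (enum_val e); rewrite -val_eqE /= ltn_eqF //.
  by rewrite -/(r _) -/(r _) -/S; field; rewrite n1 n2.
rewrite tr_incidence_edge_vec; last exact: Ucenter_sym.
by apply/matrixP => k j; rewrite !mxE Ucenter_row_sum.
Qed.

End EdgeSums.

(** * The contrast [ell_E] and the between-group indicator *)

Section TwoSampleContrast.
Context {R : realType} {n m : nat}.
Hypotheses (n_ge2 : (2 <= n)%N) (m_ge2 : (2 <= m)%N).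

Local Notation N := (n + m)%N.
Local Notation Z := (incidence R N).
Local Notation l := (ell_E R n m).
Local Notation c := (edge_vec (between_array R n m)).

Let n0 : n%:R != 0 :> R. Proof. by rewrite pnatr_eq0; lia. Qed.
Let m0 : m%:R != 0 :> R. Proof. by rewrite pnatr_eq0; lia. Qed.
Let n1 : n%:R - 1 != 0 :> R. Proof. by rewrite subr_eq0 pnatr_eq1; lia. Qed.
Let m1 : m%:R - 1 != 0 :> R. Proof. by rewrite subr_eq0 pnatr_eq1; lia. Qed.
Let N_ge3 : (3 <= N)%N. Proof. lia. Qed.

Lemma ell_dot (A : 'M[R]_N) :
  (l^T *m edge_vec A) 0 0 = avgXY A - (avgXX A + avgYY A) / 2.
Proof.
rewrite edge_vec_dot /avgXY /avgXX /avgYY.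
rewrite [X in _ * X - _]big_mkcond !mulr_sumr -big_split mulr_suml -sumrB.
apply: eq_bigr => i _ /=.
(* All block conditions become indicators over the same pairs, so that both sides can be compared
   entry by entry. *)
have -> : (if (i < n)%N then \sum_(j < N | (n <= j)%N) A i j else 0) =
    \sum_(j < N | (i < n <= j)%N) A i j.
  by case: (i < n)%N => //; rewrite big_pred0.
rewrite !mulr_sumr [LHS]big_mkcond [X in X - _]big_mkcond.
rewrite [X in (X + _) / 2]big_mkcond [X in (_ + X) / 2]big_mkcond /=.
rewrite -big_split mulr_suml -sumrB.
apply: eq_bigr => j _ /=; rewrite /ell.
case: (ltnP i j) => ij; case: (ltnP j n) => jn; case: (ltnP i n) => in_ /=;
  try (by exfalso; lia); by field; rewrite ?n0 ?n1 ?m0 ?m1.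
Qed.

Lemma ell_dot_between : (l^T *m c) 0 0 = 1.
Proof.
rewrite ell_dot.
have -> : avgXX (between_array R n m) = 0.
  rewrite /avgXX big1 ?mulr0 // => i _; apply: big1 => j /andP[ij jn].
  by rewrite mxE /group jn (ltn_trans ij jn).
have -> : avgYY (between_array R n m) = 0.
  rewrite /avgYY big1 ?mulr0 // => i _; apply: big1 => j /andP[ni ij].
  by rewrite mxE /group !ltnNge ni (leq_trans ni (ltnW ij)).
rewrite addr0 mul0r subr0 /avgXY.
rewrite (eq_bigr (fun=> m%:R)) => [|i ilt]; last first.
  rewrite (eq_bigr (fun=> 1)) => [|j nj]; last by rewrite mxE /group ilt ltnNge nj.
  rewrite big_split_ord /= big_pred0 => [|j]; last by rewrite leqNgt ltn_ord.
  by rewrite add0r (eq_bigl predT) => [|j]; rewrite ?leq_addr // sumr_const card_ord.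
rewrite big_split_ord /= [X in _ + X]big_pred0 => [|j]; last by rewrite ltnNge leq_addr.
rewrite addr0 (eq_bigl predT) => [|j]; last by rewrite /= ltn_ord.
by rewrite sumr_const card_ord -[m%:R *+ n]mulr_natl mulVf // mulf_neq0.
Qed.

(** At an X label, the [n - 1] partners in its group contribute [- 1 / n] in total and the [m]
    partners across contribute [1 / n]; the Y labels are symmetric. *)
Lemma tr_incidence_ell : Z^T *m l = 0.
Proof.
(* [ell i j] is meant for [i < j] only; [B] is its symmetric extension. *)
pose B (i j : 'I_N) : R :=
  if (i < n)%N == (j < n)%N then
    if (i < n)%N then - (n%:R * (n%:R - 1))^-1 else - (m%:R * (m%:R - 1))^-1
  else (n%:R * m%:R)^-1.
have -> : l = edge_vec B.
  apply: eq_edge_vec => i j ij; rewrite /ell /B.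
  by case: (ltnP j n) => jn; case: (ltnP i n) => in_ //=; exfalso; lia.
rewrite tr_incidence_edge_vec => [|i j]; last by rewrite /B eq_sym; case: eqP => // ->.
apply/matrixP => k z; rewrite ord1 !mxE {z}.
(* Adding and removing the diagonal entry lets the sum run over two full blocks on which [B k] is
   constant. *)
transitivity (\sum_j B k j - B k k).
  by rewrite [X in _ = X - _](bigD1 k) //= [RHS]addrC addKr.
rewrite big_split_ord /=.
under eq_bigr do rewrite /B /= ltn_ord.
under [X in _ + X - _]eq_bigr do rewrite /B /= [(_ + _ < n)%N]ltnNge leq_addr /=.
rewrite /B eqxx !sumr_const !card_ord -[_ *+ n]mulr_natl -[_ *+ m]mulr_natl.
by case: (k < n)%N => /=; field; rewrite ?n0 ?n1 ?m0 ?m1.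
Qed.

(** The closed form of [a_nm ^+ 2], from which positivity is visible. *)
Let kappa : R :=
  (n%:R * m%:R)^-1 + (2 * (n%:R * (n%:R - 1)))^-1 + (2 * (m%:R * (m%:R - 1)))^-1.

Let kappa_gt0 : 0 < kappa.
Proof.
have nR : (2 : R) <= n%:R by rewrite (ler_nat R 2).
have mR : (2 : R) <= m%:R by rewrite (ler_nat R 2).
by rewrite /kappa !addr_gt0 // invr_gt0 !mulr_gt0 //; lra.
Qed.

(* The coefficients making [Z *m beta + kappa^-1 *: l] vanish on within-group
   edges; its value on between-group edges is then [kappa / kappa = 1]. *)
Let beta : 'cV[R]_N := \col_i (kappa^-1 *
  if (i < n)%N then (2 * (n%:R * (n%:R - 1)))^-1 else (2 * (m%:R * (m%:R - 1)))^-1).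

Let between_decomp_kappa : c = Z *m beta + kappa^-1 *: l.
Proof.
have -> : kappa^-1 *: l = edge_vec (fun i j => kappa^-1 * ell R i j).
  by apply/matrixP => e j; rewrite !mxE.
have -> : Z *m beta + edge_vec (fun i j => kappa^-1 * ell R i j) =
    edge_vec (fun i j => beta i 0 + beta j 0 + kappa^-1 * ell R i j).
  by rewrite incidence_edge_vec; apply/matrixP => e j; rewrite !mxE.
apply: eq_edge_vec => i j ij; rewrite !mxE /ell /group -!mulrDr.
case: (ltnP j n) => jn; case: (ltnP i n) => in_ /=; try (by exfalso; lia).
- rewrite [X in _ * X](_ : _ = 0) ?mulr0 //.
  by field; rewrite n0 n1.
- rewrite [X in _ * X](_ : _ = kappa); last by rewrite /kappa; ring.
  by rewrite mulVf // gt_eqF.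
- rewrite [X in _ * X](_ : _ = 0) ?mulr0 //.
  by field; rewrite m0 m1.
Qed.

(* Both sides of [between_decomp_kappa] are paired with [l], which is orthogonal
   to the columns of [Z] and has inner product 1 with [c]. *)
Let sqnorm_ell_kappa : sqnorm l = kappa.
Proof.
have lZ : l^T *m Z = 0 by exact: tr_residual_dot tr_incidence_ell.
have := ell_dot_between.
rewrite between_decomp_kappa mulmxDr mulmxA lZ mul0mx add0r -scalemxAr mxE.
rewrite -sqnormE => /(congr1 ( *%R kappa)).
by rewrite mulr1 mulVKf // gt_eqF.
Qed.

Lemma sqnorm_ell_gt0 : 0 < sqnorm l.
Proof. by rewrite sqnorm_ell_kappa. Qed.

Lemma between_decomp :
  exists beta : 'cV[R]_N, c = Z *m beta + (sqnorm l)^-1 *: l.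
Proof. by exists beta; rewrite sqnorm_ell_kappa. Qed.

Lemma a_nm_sqr : a_nm R n m ^+ 2 = sqnorm l.
Proof. by rewrite sqr_sqrtr // sqnorm_ge0. Qed.

Lemma a_nm_gt0 : 0 < a_nm R n m.
Proof. by rewrite sqrtr_gt0 sqnorm_ell_gt0. Qed.

Lemma residual_between : residual_proj R N *m c = (sqnorm l)^-1 *: l.
Proof.
have [b cE] := between_decomp; apply: residual_proj_decomp cE _ => //.
by rewrite -scalemxAr tr_incidence_ell scaler0.
Qed.

Lemma ell_residual (y : 'cV[R]_#|{: edge N}|) :
  l^T *m (residual_proj R N *m y) = l^T *m y.
Proof.
rewrite /residual_proj mulmxBl mul1mx mulmxBr !mulmxA.
by rewrite (tr_residual_dot _ _ tr_incidence_ell) !mul0mx subr0.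
Qed.

Lemma between_array_sym i j : between_array R n m i j = between_array R n m j i.
Proof. by rewrite !mxE eq_sym. Qed.

Lemma energy_half (A : 'M[R]_N) :
  avgXY A - (avgXX A + avgYY A) / 2 = sample_energy A / 2.
Proof. by rewrite /sample_energy; field. Qed.

Lemma energy_Ucenter (A : 'M[R]_N) : (forall i j, A i j = A j i) ->
  sample_energy A = 2 * a_nm R n m ^+ 2 *
    \sum_(i < N) \sum_(j < N | (i < j)%N)
      Ucenter A i j * Ucenter (between_array R n m) i j.
Proof.
move=> As.
(* The factor of [C] goes first, so that its projection, a multiple of [l], stands on the left and
   absorbs the projector applied to [A]. *)
under eq_bigr do under eq_bigr do rewrite mulrC.
rewrite -edge_vec_dot (edge_vec_Ucenter N_ge3 _ As).
rewrite (edge_vec_Ucenter N_ge3 _ between_array_sym) residual_between.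
rewrite tr_scale_mulmx ell_residual mxE ell_dot energy_half a_nm_sqr.
by have := sqnorm_ell_gt0 => l0; field; rewrite gt_eqF.
Qed.

End TwoSampleContrast.

(** * The identities for the pooled sample at a fixed outcome *)

Theorem proposition4p2 (R : realType) (dO dZ : measure_display)
  (Omega : measurableType dO) (Z : measurableType dZ)
  (Pr : probability Omega R) (P Q : probability Z R)
  (n m : nat) (hn : (2 <= n)%N) (hm : (2 <= m)%N)
  (X : 'I_n -> {RV Pr >-> Z}) (Y : 'I_m -> {RV Pr >-> Z})
  (lawX : forall i, has_law (X i) P) (lawY : forall j, has_law (Y j) Q)
  (indep : mutually_independent (pool X Y))
  (rho : Z * Z -> R)
  (rho_meas : measurable_fun [set: Z * Z] rho)
  (rho_sym : forall z w, rho (z, w) = rho (w, z))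
  (rho_XY : (P \x Q)%E.-integrable [set: Z * Z] (EFin \o rho))
  (rho_XX : (P \x P)%E.-integrable [set: Z * Z] (EFin \o rho))
  (rho_YY : (Q \x Q)%E.-integrable [set: Z * Z] (EFin \o rho))
  (omega : Omega) :
  let N := (n + m)%N in
  let A : 'M[R]_N := dissim_array rho (fun i => pool X Y i omega) in
  let C : 'M[R]_N := between_array R n m in
  let a_E := edge_vec A in
  let c_E := edge_vec C in
  let l_E := ell_E R n m in
  let a := a_nm R n m in
  [/\ 0 < a,
      residual_proj R N *m c_E = (a ^+ 2)^-1 *: l_E,
      (exists gamma theta, least_squares_fit a_E (incidence R N) c_E gamma theta)
      /\ (forall gamma theta,
            least_squares_fit a_E (incidence R N) c_E gamma theta ->
            [/\ theta = (l_E^T *m a_E) 0 0,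
                (l_E^T *m a_E) 0 0 = avgXY A - (avgXX A + avgYY A) / 2
              & avgXY A - (avgXX A + avgYY A) / 2 = sample_energy A / 2])
    & sample_energy A =
        2 * a ^+ 2 *
        \sum_(i < N) \sum_(j < N | (i < j)%N) Ucenter A i j * Ucenter C i j].
Proof.
move=> N A C a_E c_E l_E a.
have A_sym i j : A i j = A j i by rewrite !mxE eq_sym; case: eqP => // _; exact: rho_sym.
have Zu : (incidence R N)^T *m incidence R N \in unitmx.
  by apply: incidence_gram_unit; rewrite /N; lia.
have Zl := @tr_incidence_ell R n m hn hm.
have l0 := @sqnorm_ell_gt0 R n m hn hm.
have [beta cE] := @between_decomp R n m hn hm.
split.
- exact: a_nm_gt0.
- by rewrite a_nm_sqr; exact: residual_between.
- split; first exact: fit_exists Zu Zl l0 cE.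
  move=> gamma theta fit; split; first exact: fit_slope Zl l0 cE _ _ fit.
  + exact: ell_dot.
  + exact: energy_half.
- exact: energy_Ucenter.
Qed.
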